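(* For the relay Markov decision process $\{(Y_n,A_n),n\ge0\}$ described in the context, the optimal policy (minimizing the long-run average cost $V(u)=\lim_{N\to\infty}\frac{1}{N+1}E_u[\sum_{n=0}^N C(Y_n,A_n)\mid Y_0=(0,0)]$) is of threshold type: there exist nonnegative integers $L_1^*,L_2^*$ such that the optimal deterministic action in state $(i,0)$ is to wait ($A_n=0$) if $i\le L_1^*$ and to transmit without coding ($A_n=1$) if $i>L_1^*$, while in state $(0,j)$ it is to wait if $j\le L_2^*$ and to transmit without coding if $j>L_2^*$.
   Context: A relay node keeps two queues $q_1,q_2$. Time is slotted; in each slot a packet arrives to $q_i$ with probability $p_i\in(0,1)$ ($i=1,2$), independently across queues and slots, at most one per queue per slot. $Y_n=(Y_n^1,Y_n^2)$ is the number of packets in $(q_1,q_2)$ at the end of slot $n$ just before the transmission opportunity, and $A_n\in\{0,1\}$ is the action ($0$ = do nothing, $1$ = transmit). If $Y^1_n+Y^2_n=0$ then $A_n=0$; if $Y^1_nY^2_n>0$ then $A_n=1$ (XOR-coded transmission of one packet from each queue). The state space is $\{(i,j)\in\mathbb{Z}_{\ge0}^2:\min(i,j)\le1\}$. With $\hat p_1=(1-p_1)(1-p_2)$, $\hat p_2=p_1(1-p_2)$, $\hat p_3=(1-p_1)p_2$, $\hat p_4=p_1p_2$, $[x]^+=\max(x,0)$: $P_1((i,j),([i-1]^+,[j-1]^+))=\hat p_1$, $P_1((i,j),(\max(i,1),[j-1]^+))=\hat p_2$, $P_1((i,j),([i-1]^+,\max(j,1)))=\hat p_3$, $P_1((i,j),(\max(i,1),\max(j,1)))=\hat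 p_4$, $P_0((i,j),(i,j))=\hat p_1$, $P_0((i,j),(i+1,j))=\hat p_2$, $P_0((i,j),(i,j+1))=\hat p_3$, $P_0((i,j),(i+1,j+1))=\hat p_4$. One-step cost: $C(Y_n,A_n)=C_h([Y^1_n-A_n]^+ + [Y^2_n-A_n]^+)+C_tA_n$, where $C_t>0$ is the transmission cost and $C_h>0$ the per-slot holding cost. *)

(* Defs.v *)
From Stdlib Require Import Reals List Arith.
From Coquelicot Require Import Coquelicot.
Import ListNotations.
Open Scope R_scope.

(* A state (i,j) = numbers of packets in (q1,q2). *)
Definition state := (nat * nat)%type.

(* Actions: false = 0 (do nothing), true = 1 (transmit). *)
Definition act_nat (a : bool) : nat := if a then 1%nat else 0%nat.

(* Transition kernel P_a(y, .) as a list of (probability, next state).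
   Natural-number subtraction [i - 1] is truncated, i.e. [i-1]^+. *)
Definition trans (p1 p2 : R) (y : state) (a : bool) : list (R * state) :=
  let (i, j) := y in
  let ph1 := (1 - p1) * (1 - p2) in
  let ph2 := p1 * (1 - p2) in
  let ph3 := (1 - p1) * p2 in
  let ph4 := p1 * p2 in
  if a then
    [ (ph1, (i - 1, j - 1)%nat); (ph2, (Nat.max i 1, j - 1)%nat);
      (ph3, (i - 1, Nat.max j 1)%nat); (ph4, (Nat.max i 1, Nat.max j 1)) ]
  else
    [ (ph1, (i, j)); (ph2, (S i, j)); (ph3, (i, S j)); (ph4, (S i, S j)) ].

Definition cost (Ch Ct : R) (y : state) (a : bool) : R :=
  Ch * INR ((fst y - act_nat a) + (snd y - act_nat a))%nat + Ct * INR (act_nat a).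

(* A (general, history-dependent, randomized) policy: given the past
   history of (state, action) pairs and the current state, the
   probability of transmitting (A_n = 1). *)
Definition history := list (state * bool).
Definition policy := history -> state -> R.

Definition admissible (pol : policy) : Prop :=
  forall (h : history) (y : state),
    0 <= pol h y <= 1 /\
    ((fst y + snd y = 0)%nat -> pol h y = 0) /\
    ((0 < fst y * snd y)%nat -> pol h y = 1).

Fixpoint exp_cost (p1 p2 Ch Ct : R) (pol : policy) (N : nat)
         (h : history) (y : state) {struct N} : R :=
  let q := pol h y in
  let cont (a : bool) : R :=
    match N with
    | O => 0
    | S N' => fold_right
                (fun e acc => fst e * exp_cost p1 p2 Ch Ct pol N' (h ++ [(y, a)]) (snd e) + acc)
                0 (trans p1 p2 y a)
    end in
  q * (cost Ch Ct y true + cont true) + (1 - q) * (cost Ch Ct y false + cont false).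

Definition avg_cost (p1 p2 Ch Ct : R) (pol : policy) : Rbar :=
  LimSup_seq (fun N => exp_cost p1 p2 Ch Ct pol N [] (0%nat, 0%nat) / INR (S N)).

Definition threshold_policy (L1 L2 : nat) : policy :=
  fun _ y =>
    if Nat.ltb 0 (fst y * snd y) then 1
    else if Nat.eqb (snd y) 0 then (if Nat.ltb L1 (fst y) then 1 else 0)
    else (if Nat.ltb L2 (snd y) then 1 else 0).

(* Main.v *)
(** After each decision at most one queue is nonempty, so the post-decision state
    is an integer [x].  Let [f x] be the marginal cost of the [x]-th packet of [q1]
    for [x >= 1], and [Ct] minus the marginal cost of the [(1-x)]-th packet of [q2]
    for [x <= 0].  A packet can always be disposed of by a transmission, so [f] takes
    values in [[0, Ct]], and the optimality equation becomes an obstacle problem: the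
    drift of the potential obtained by summing [f] is constant wherever [f] avoids
    the obstacles [0] and [Ct].  Monotone iteration yields a nondecreasing solution,
    which grows by at least [Ch] per step until it hits the obstacles; the hitting
    points are the thresholds.  The drift is then at least a constant [g]
    everywhere, with equality along the threshold policy.  Exchanging the queues
    replaces [f x] by [Ct - f (1 - x)], so it suffices to argue for [x >= 1]. *)

Require Import Defs.
From Stdlib Require Import Reals List Arith.
From Coquelicot Require Import Coquelicot.
From Stdlib Require Import ZArith Lra Lia.
Import ListNotations.
Open Scope R_scope.

(** * Clamping and monotone iteration *)

Definition clamp (C z : R) : R := Rmax 0 (Rmin C z).

Lemma clamp_bounds (C z : R) : 0 <= C -> 0 <= clamp C z <= C.
Proof.
  intros HC; unfold clamp, Rmax, Rmin.
  destruct (Rle_dec C z); destruct (Rle_dec 0 _); lra.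
Qed.

Lemma clamp_le (C z t : R) : z <= t -> clamp C z <= clamp C t.
Proof. intros Hzt; apply Rle_max_compat_l, Rle_min_compat_l, Hzt. Qed.

Lemma clamp_reflect (C z : R) : 0 <= C -> clamp C (C - z) = C - clamp C z.
Proof.
  intros HC; unfold clamp, Rmax, Rmin.
  repeat destruct Rle_dec; lra.
Qed.

Lemma clamp_fixed_neg (C z d : R) : 0 <= C -> z = clamp C (z + d) -> d < 0 -> z = 0.
Proof.
  unfold clamp, Rmax, Rmin; intros HC Hz Hd; revert Hz.
  repeat destruct Rle_dec; lra.
Qed.

Lemma clamp_fixed_pos (C z d : R) : 0 <= C -> z = clamp C (z + d) -> 0 < d -> z = C.
Proof.
  unfold clamp, Rmax, Rmin; intros HC Hz Hd; revert Hz.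
  repeat destruct Rle_dec; lra.
Qed.

Lemma is_lim_seq_clamp (C l : R) (u : nat -> R) :
  is_lim_seq u l -> is_lim_seq (fun n => clamp C (u n)) (clamp C l).
Proof.
  apply is_lim_seq_continuous.
  intros eps Heps; exists eps; split; [exact Heps|]; intros x [_ Hx].
  simpl in *; unfold Rdist in *; revert Hx.
  unfold clamp, Rmax, Rmin, Rabs; repeat destruct Rcase_abs;
    repeat destruct Rle_dec; lra.
Qed.

Lemma monotone_iteration_fixpoint {X : Type} (T : (X -> R) -> X -> R) (lo hi : X -> R) :
  (forall f h, (forall x, f x <= h x) -> forall x, T f x <= T h x) ->
  (forall u f, (forall x, is_lim_seq (fun n => u n x) (Finite (f x))) ->
    forall x, is_lim_seq (fun n => T (u n) x) (T f x)) ->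
  (forall x, lo x <= hi x) -> (forall x, lo x <= T lo x) -> (forall x, T hi x <= hi x) ->
  exists f, (forall x, is_lim_seq (fun n => Nat.iter n T lo x) (Finite (f x)))
    /\ forall x, f x = T f x.
Proof.
  intros Hmono Hcont Hlohi Hlo Hhi; set (u n := Nat.iter n T lo).
  assert (Hincr : forall n x, u n x <= u (S n) x).
  { induction n as [|n IH]; [exact Hlo|]; apply (Hmono _ _ IH). }
  assert (Hbound : forall n x, u n x <= hi x).
  { induction n as [|n IH]; [exact Hlohi|]; intros x.
    apply Rle_trans with (T hi x); [apply (Hmono _ _ IH)|apply Hhi]. }
  assert (Hlim : forall x, is_lim_seq (fun n => u n x)
                             (Finite (real (Lim_seq (fun n => u n x))))).
  { intros x; apply Lim_seq_correct', ex_finite_lim_seq_incr with (hi x);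
      [intros n; apply Hincr|intros n; apply Hbound]. }
  exists (fun x => real (Lim_seq (fun n => u n x))); split; [exact Hlim|]; intros x.
  assert (Hnext : is_lim_seq (fun n => u (S n) x)
                    (T (fun y => real (Lim_seq (fun n => u n y))) x))
    by apply (Hcont u _ Hlim).
  apply is_lim_seq_unique in Hnext.
  rewrite (Lim_seq_incr_1 (fun n => u n x)) in Hnext.
  exact (f_equal real Hnext).
Qed.

Lemma first_hitting_index (C c : R) (u : nat -> R) :
  0 < c -> 0 <= u O -> (forall n, u n <= C) ->
  (forall n, u (S n) < C -> u n + c <= u (S n)) ->
  exists n, u (S n) = C /\ forall m, (1 <= m <= n)%nat -> u m < C.
Proof.
  intros Hc Hstart HC Hgrowth.
  assert (Hdichotomy : forall n,
    (exists m, u (S m) = C /\ forall k, (1 <= k <= m)%nat -> u k < C) \/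
    (INR n * c <= u n /\ forall k, (1 <= k <= n)%nat -> u k < C)).
  { induction n as [|n [IH|[IHlinear IHbelow]]]; [|left; exact IH|].
    - right; split; [simpl; lra|intros; lia].
    - destruct (Rle_lt_or_eq_dec _ _ (HC (S n))) as [Hlt|Heq].
      + right; split; [rewrite S_INR; specialize (Hgrowth n Hlt); lra|].
        intros k Hk; destruct (Nat.eq_dec k (S n)) as [->|]; [exact Hlt|].
        apply IHbelow; lia.
      + left; exists n; auto. }
  destruct (INR_archimed c C Hc) as [N HN].
  destruct (Hdichotomy N) as [Hhit|[Hlinear _]]; [exact Hhit|].
  specialize (HC N); lra.
Qed.

(** * The obstacle problem for the marginal costs *)

(* The one-step drift, when waiting at the post-decision state [x] (the contents of
   [q1] if [0 <= x], minus those of [q2] otherwise), of the potential that increases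
   by [f k] with the [k]-th packet of [q1] and by [Ct - f (1 - k)] with that of [q2]. *)
Definition drift (p1 p2 Ch Ct : R) (f : Z -> R) (x : Z) : R :=
  Ch * IZR (Z.abs x) + p1 * (1 - p2) * f (x + 1)%Z
  + (1 - p1) * p2 * (Ct - f x) + p1 * p2 * Ct.

Lemma drift_ge_holding_cost (p1 p2 Ch Ct : R) (f : Z -> R) (x : Z) :
  0 <= p1 <= 1 -> 0 <= p2 <= 1 -> 0 <= Ct -> (forall y, 0 <= f y <= Ct) ->
  Ch * IZR (Z.abs x) <= drift p1 p2 Ch Ct f x.
Proof.
  intros Hp1 Hp2 HCt Hf; unfold drift.
  assert (Hx := Hf x); assert (Hx1 := Hf (x + 1)%Z).
  assert (0 <= p1 * (1 - p2) * f (x + 1)%Z) by (repeat apply Rmult_le_pos; lra).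
  assert (0 <= (1 - p1) * p2 * (Ct - f x)) by (repeat apply Rmult_le_pos; lra).
  assert (0 <= p1 * p2 * Ct) by (repeat apply Rmult_le_pos; lra).
  lra.
Qed.

Lemma drift_increment (p1 p2 Ch Ct : R) (f : Z -> R) (x : Z) :
  f x + (drift p1 p2 Ch Ct f x - drift p1 p2 Ch Ct f (x - 1)) =
  Ch * IZR (Z.abs x - Z.abs (x - 1)) + p1 * (1 - p2) * f (x + 1)%Z
  + (1 - p1) * p2 * f (x - 1)%Z + ((1 - p1) * (1 - p2) + p1 * p2) * f x.
Proof.
  unfold drift; replace (x - 1 + 1)%Z with x by lia; rewrite minus_IZR; ring.
Qed.

Definition reflect (C : R) (f : Z -> R) (x : Z) : R := C - f (1 - x)%Z.

Lemma drift_reflect (p1 p2 Ch Ct : R) (f : Z -> R) (x : Z) :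
  drift p2 p1 Ch Ct (reflect Ct f) x = drift p1 p2 Ch Ct f (- x).
Proof.
  unfold drift, reflect; rewrite Z.abs_opp.
  replace (1 - (x + 1))%Z with (- x)%Z by lia.
  replace (- x + 1)%Z with (1 - x)%Z by lia; ring.
Qed.

(* The value-iteration operator of a Dynkin game with stopping payoffs [0] and [Ct];
   [drift_increment] exhibits the underlying random walk. *)
Definition relax (p1 p2 Ch Ct : R) (f : Z -> R) (x : Z) : R :=
  clamp Ct (f x + (drift p1 p2 Ch Ct f x - drift p1 p2 Ch Ct f (x - 1))).

Record monotone_solution (p1 p2 Ch Ct : R) (f : Z -> R) : Prop := MonotoneSolution {
  solution_nondecreasing : forall x y, (x <= y)%Z -> f x <= f y;
  solution_fixed : forall x, f x = relax p1 p2 Ch Ct f x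
}.

Arguments solution_nondecreasing {p1 p2 Ch Ct f} _ _ _ _.
Arguments solution_fixed {p1 p2 Ch Ct f} _ _.

Lemma monotone_solution_reflect (p1 p2 Ch Ct : R) (f : Z -> R) :
  0 <= Ct -> monotone_solution p1 p2 Ch Ct f ->
  monotone_solution p2 p1 Ch Ct (reflect Ct f).
Proof.
  intros HCt [Hmono Hfix]; split.
  - intros x y Hxy; specialize (Hmono (1 - y)%Z (1 - x)%Z ltac:(lia)).
    unfold reflect; lra.
  - intros x; unfold relax; rewrite !drift_reflect; unfold reflect.
    rewrite (Hfix (1 - x)%Z) at 1; unfold relax.
    rewrite <- clamp_reflect by exact HCt.
    replace (- (x - 1))%Z with (1 - x)%Z by lia.
    replace (1 - x - 1)%Z with (- x)%Z by lia.
    f_equal; ring.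
Qed.

Section ObstacleProblem.

Variables p1 p2 Ch Ct : R.
Hypothesis p1_prob : 0 <= p1 <= 1.
Hypothesis p2_prob : 0 <= p2 <= 1.
Hypothesis Ch_pos : 0 < Ch.
Hypothesis Ct_nonneg : 0 <= Ct.

Lemma arrival_probs_nonneg :
  0 <= p1 * (1 - p2) /\ 0 <= (1 - p1) * p2 /\ 0 <= (1 - p1) * (1 - p2) + p1 * p2.
Proof. repeat split; repeat apply Rplus_le_le_0_compat; apply Rmult_le_pos; lra. Qed.

Lemma relax_le (f h : Z -> R) :
  (forall x, f x <= h x) ->
  forall x, relax p1 p2 Ch Ct f x <= relax p1 p2 Ch Ct h x.
Proof.
  intros Hfh x; apply clamp_le; rewrite !drift_increment.
  destruct arrival_probs_nonneg as [Hright [Hleft Hstay]].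
  repeat apply Rplus_le_compat; try apply Rle_refl;
    apply Rmult_le_compat_l; auto.
Qed.

Lemma relax_nondecreasing (f : Z -> R) :
  (forall x y, (x <= y)%Z -> f x <= f y) ->
  forall x y, (x <= y)%Z -> relax p1 p2 Ch Ct f x <= relax p1 p2 Ch Ct f y.
Proof.
  intros Hf x y Hxy; apply clamp_le; rewrite !drift_increment.
  destruct arrival_probs_nonneg as [Hright [Hleft Hstay]].
  repeat apply Rplus_le_compat; apply Rmult_le_compat_l; auto; try lra;
    [apply IZR_le|apply Hf|apply Hf]; lia.
Qed.

Lemma is_lim_seq_relax (u : nat -> Z -> R) (f : Z -> R) :
  (forall x, is_lim_seq (fun n => u n x) (f x)) ->
  forall x, is_lim_seq (fun n => relax p1 p2 Ch Ct (u n) x) (relax p1 p2 Ch Ct f x).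
Proof.
  intros Hu.
  assert (Hdrift : forall x, is_lim_seq (fun n => drift p1 p2 Ch Ct (u n) x)
                               (drift p1 p2 Ch Ct f x)).
  { intros x; unfold drift.
    repeat apply is_lim_seq_plus'; try apply is_lim_seq_const;
      apply (is_lim_seq_scal_l _ _ (Finite _)); [apply Hu|].
    apply is_lim_seq_minus'; [apply is_lim_seq_const|apply Hu]. }
  intros x; apply is_lim_seq_clamp, is_lim_seq_plus'; [apply Hu|].
  apply is_lim_seq_minus'; apply Hdrift.
Qed.

Lemma monotone_solution_exists : exists f, monotone_solution p1 p2 Ch Ct f.
Proof.
  destruct (monotone_iteration_fixpoint (relax p1 p2 Ch Ct) (fun _ => 0) (fun _ => Ct))
    as [f [Hlim Hfix]]; auto using relax_le, is_lim_seq_relax;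
    try (intros; apply clamp_bounds; exact Ct_nonneg).
  assert (Hiter : forall n x y, (x <= y)%Z ->
    Nat.iter n (relax p1 p2 Ch Ct) (fun _ => 0) x
      <= Nat.iter n (relax p1 p2 Ch Ct) (fun _ => 0) y).
  { induction n as [|n IH]; [intros; apply Rle_refl|].
    exact (relax_nondecreasing _ IH). }
  exists f; split; [|exact Hfix]; intros x y Hxy.
  exact (is_lim_seq_le _ _ (Finite _) (Finite _)
           (fun n => Hiter n x y Hxy) (Hlim x) (Hlim y)).
Qed.

Variable f : Z -> R.
Hypothesis f_solution : monotone_solution p1 p2 Ch Ct f.

Lemma solution_bounds (x : Z) : 0 <= f x <= Ct.
Proof. rewrite (solution_fixed f_solution); apply clamp_bounds, Ct_nonneg. Qed.

(* Where the drift decreases [f] vanishes, but there the holding cost alone makes the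
   drift increase. *)
Lemma solution_drift_le_succ (x : Z) :
  (0 <= x)%Z -> drift p1 p2 Ch Ct f x <= drift p1 p2 Ch Ct f (x + 1).
Proof.
  intros Hx; apply Rnot_lt_le; intros Hdecr.
  assert (Hfix := solution_fixed f_solution (x + 1)%Z).
  assert (Hincr := drift_increment p1 p2 Ch Ct f (x + 1)).
  unfold relax in Hfix; replace (x + 1 - 1)%Z with x in * by lia.
  assert (Hzero : f (x + 1)%Z = 0)
    by (apply (clamp_fixed_neg _ _ _ Ct_nonneg Hfix); lra).
  replace (Z.abs (x + 1) - Z.abs x)%Z with 1%Z in Hincr by lia.
  rewrite Hzero in Hincr.
  destruct arrival_probs_nonneg as [Hright [Hleft _]].
  assert (Hfrom_right := Rmult_le_pos _ _ Hright (proj1 (solution_bounds (x + 1 + 1)))).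
  assert (Hfrom_left := Rmult_le_pos _ _ Hleft (proj1 (solution_bounds x))).
  lra.
Qed.

Lemma solution_drift_eq_succ (x : Z) :
  (0 <= x)%Z -> f (x + 1)%Z < Ct ->
  drift p1 p2 Ch Ct f (x + 1) = drift p1 p2 Ch Ct f x.
Proof.
  intros Hx Hlt; apply Rle_antisym; [|apply solution_drift_le_succ, Hx].
  apply Rnot_lt_le; intros Hincr.
  assert (Hfix := solution_fixed f_solution (x + 1)%Z).
  unfold relax in Hfix; replace (x + 1 - 1)%Z with x in * by lia.
  apply clamp_fixed_pos in Hfix; lra.
Qed.

Lemma solution_growth (x : Z) :
  (0 <= x)%Z -> f (x + 1)%Z < Ct -> f x + Ch <= f (x + 1)%Z.
Proof.
  intros Hx Hlt.
  assert (Hincr := drift_increment p1 p2 Ch Ct f (x + 1)).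
  replace (x + 1 - 1)%Z with x in Hincr by lia.
  rewrite (solution_drift_eq_succ x Hx Hlt) in Hincr.
  replace (Z.abs (x + 1) - Z.abs x)%Z with 1%Z in Hincr by lia.
  assert (Hmono := solution_nondecreasing f_solution).
  assert (Hbelow := Hmono x (x + 1)%Z ltac:(lia)).
  assert (Habove := Hmono (x + 1)%Z (x + 1 + 1)%Z ltac:(lia)).
  destruct arrival_probs_nonneg as [Hright _].
  assert (Hjump : Ch <= (1 - p1) * p2 * (f (x + 1)%Z - f x)).
  { apply (Rmult_le_compat_l _ _ _ Hright) in Habove; lra. }
  assert (Hprob : (1 - p1) * p2 <= 1) by nra.
  nra.
Qed.

Lemma solution_drift_min_at_0 (n : nat) :
  drift p1 p2 Ch Ct f 0 <= drift p1 p2 Ch Ct f (Z.of_nat n).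
Proof.
  induction n as [|n IH]; [apply Rle_refl|].
  rewrite Nat2Z.inj_succ; eapply Rle_trans; [exact IH|].
  apply solution_drift_le_succ; lia.
Qed.

Lemma solution_threshold :
  exists L : nat, f (Z.of_nat L + 1)%Z = Ct /\
    forall n, (n <= L)%nat -> drift p1 p2 Ch Ct f (Z.of_nat n) = drift p1 p2 Ch Ct f 0.
Proof.
  destruct (first_hitting_index Ct Ch (fun n => f (Z.of_nat n))) as [L [Hhit Hbelow]];
    try apply solution_bounds; auto.
  - intros n; apply solution_bounds.
  - intros n; rewrite Nat2Z.inj_succ; apply solution_growth; lia.
  - rewrite Nat2Z.inj_succ in Hhit; exists L; split; [exact Hhit|].
    induction n as [|n IH]; [reflexivity|]; intros Hn.
    specialize (Hbelow (S n) ltac:(lia)); rewrite Nat2Z.inj_succ in *.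
    unfold Z.succ in *; rewrite <- IH by lia.
    apply solution_drift_eq_succ; [lia|exact Hbelow].
Qed.

End ObstacleProblem.

Record threshold_certificate (p1 p2 Ch Ct : R) (f : Z -> R) (g : R) (L1 L2 : nat) :
  Prop := ThresholdCertificate {
    certificate_bounds : forall x, 0 <= f x <= Ct;
    certificate_right : f (Z.of_nat L1 + 1)%Z = Ct;
    certificate_left : f (- Z.of_nat L2)%Z = 0;
    certificate_drift_ge : forall x, g <= drift p1 p2 Ch Ct f x;
    certificate_drift_eq : forall x, (- Z.of_nat L2 <= x <= Z.of_nat L1)%Z ->
      drift p1 p2 Ch Ct f x = g
  }.

Arguments certificate_bounds {p1 p2 Ch Ct f g L1 L2} _ _.

Lemma monotone_solution_threshold_certificate (p1 p2 Ch Ct : R) (f : Z -> R) :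
  0 <= p1 <= 1 -> 0 <= p2 <= 1 -> 0 < Ch -> 0 <= Ct ->
  monotone_solution p1 p2 Ch Ct f ->
  exists L1 L2, threshold_certificate p1 p2 Ch Ct f (drift p1 p2 Ch Ct f 0) L1 L2.
Proof.
  intros Hp1 Hp2 HCh HCt Hf.
  assert (Hrefl := monotone_solution_reflect _ _ _ _ _ HCt Hf).
  destruct (solution_threshold _ _ _ _ Hp1 Hp2 HCh HCt _ Hf)
    as [L1 [Hhit_right Heq_right]].
  destruct (solution_threshold _ _ _ _ Hp2 Hp1 HCh HCt _ Hrefl)
    as [L2 [Hhit_left Heq_left]].
  assert (Hge_right := solution_drift_min_at_0 _ _ _ _ Hp1 Hp2 HCh HCt _ Hf).
  assert (Hge_left := solution_drift_min_at_0 _ _ _ _ Hp2 Hp1 HCh HCt _ Hrefl).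
  exists L1, L2; split; [|exact Hhit_right| | |].
  - apply (solution_bounds _ _ _ _ HCt _ Hf).
  - unfold reflect in Hhit_left.
    replace (1 - (Z.of_nat L2 + 1))%Z with (- Z.of_nat L2)%Z in Hhit_left by lia; lra.
  - intros x; destruct (Z.le_ge_cases 0 x).
    + rewrite <- (Z2Nat.id x) by lia; apply Hge_right.
    + specialize (Hge_left (Z.to_nat (- x))); rewrite !drift_reflect in Hge_left.
      rewrite Z2Nat.id, Z.opp_involutive in Hge_left by lia; exact Hge_left.
  - intros x Hx; destruct (Z.le_ge_cases 0 x).
    + rewrite <- (Z2Nat.id x) by lia; apply Heq_right; lia.
    + specialize (Heq_left (Z.to_nat (- x)) ltac:(lia)).
      rewrite !drift_reflect in Heq_left.
      rewrite Z2Nat.id, Z.opp_involutive in Heq_left by lia; exact Heq_left.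
Qed.

Definition truncate (C : R) (K : nat) (f : Z -> R) (x : Z) : R :=
  if Z.ltb (Z.of_nat K) x then 0
  else if Z.leb x (- Z.of_nat K) then C
  else f x.

Lemma truncate_bounds (C : R) (K : nat) (f : Z -> R) (x : Z) :
  (forall y, 0 <= f y <= C) -> 0 <= truncate C K f x <= C.
Proof.
  intros Hf; specialize (Hf x); unfold truncate.
  destruct (Z.ltb _ x); [|destruct (Z.leb x _)]; lra.
Qed.

Lemma truncate_inside (C : R) (K : nat) (f : Z -> R) (x : Z) :
  (- Z.of_nat K < x <= Z.of_nat K)%Z -> truncate C K f x = f x.
Proof.
  intros Hx; unfold truncate.
  destruct (Z.ltb_spec (Z.of_nat K) x); [lia|].
  destruct (Z.leb_spec x (- Z.of_nat K)); [lia|reflexivity].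
Qed.

Lemma truncate_right (C : R) (K : nat) (f : Z -> R) (x : Z) :
  (Z.of_nat K < x)%Z -> truncate C K f x = 0.
Proof. intros Hx; unfold truncate; apply Z.ltb_lt in Hx; rewrite Hx; reflexivity. Qed.

Lemma truncate_left (C : R) (K : nat) (f : Z -> R) (x : Z) :
  (x <= - Z.of_nat K)%Z -> truncate C K f x = C.
Proof.
  intros Hx; unfold truncate.
  destruct (Z.ltb_spec (Z.of_nat K) x); [lia|].
  apply Z.leb_le in Hx; rewrite Hx; reflexivity.
Qed.

(* Far from the origin the holding cost alone exceeds [g], so the increments of the
   potential may be dropped there, which makes the potential bounded. *)
Lemma threshold_certificate_truncate (p1 p2 Ch Ct : R) (f : Z -> R) (g : R)
    (L1 L2 : nat) :
  0 <= p1 <= 1 -> 0 <= p2 <= 1 -> 0 < Ch -> 0 <= Ct ->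
  threshold_certificate p1 p2 Ch Ct f g L1 L2 ->
  exists K, threshold_certificate p1 p2 Ch Ct (truncate Ct K f) g L1 L2.
Proof.
  intros Hp1 Hp2 HCh HCt [Hf Hright Hleft Hge Heq].
  destruct (INR_archimed Ch g HCh) as [M HM].
  set (K := (M + L1 + L2 + 1)%nat); exists K.
  assert (Hdrift : forall x, (Z.abs x < Z.of_nat K)%Z ->
    drift p1 p2 Ch Ct (truncate Ct K f) x = drift p1 p2 Ch Ct f x).
  { intros x Hx; unfold drift; rewrite !truncate_inside by lia; reflexivity. }
  split.
  - intros x; apply truncate_bounds, Hf.
  - rewrite truncate_inside by lia; exact Hright.
  - rewrite truncate_inside by lia; exact Hleft.
  - intros x; destruct (Z_lt_dec (Z.abs x) (Z.of_nat K)) as [Hx|Hx].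
    + rewrite Hdrift by exact Hx; apply Hge.
    + apply Rle_trans with (Ch * IZR (Z.abs x));
        [|apply drift_ge_holding_cost; auto; intros; apply truncate_bounds, Hf].
      assert (Habs : INR M <= IZR (Z.abs x)) by (rewrite INR_IZR_INZ; apply IZR_le; lia).
      apply (Rmult_le_compat_l Ch) in Habs; lra.
  - intros x Hx; rewrite Hdrift by lia; apply Heq, Hx.
Qed.

(** * The potential of the decision process *)

Fixpoint partial_sum (f : Z -> R) (n : nat) : R :=
  match n with
  | O => 0
  | S m => partial_sum f m + f (Z.of_nat n)
  end.

Lemma partial_sum_nonneg (f : Z -> R) (n : nat) :
  (forall x, 0 <= f x) -> 0 <= partial_sum f n.
Proof.
  intros Hf; induction n as [|n IH]; [apply Rle_refl|].
  apply Rplus_le_le_0_compat; [exact IH|apply Hf].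
Qed.

Lemma partial_sum_le_of_support (C : R) (K : nat) (f : Z -> R) (n : nat) :
  0 <= C -> (forall x, f x <= C) -> (forall x, (Z.of_nat K < x)%Z -> f x = 0) ->
  partial_sum f n <= C * INR K.
Proof.
  intros HC Hf Hsupport.
  assert (Hmin : partial_sum f n <= C * INR (Nat.min n K)).
  { induction n as [|n IH]; [simpl; lra|].
    cbn [partial_sum]; destruct (le_lt_dec (S n) K) as [Hn|Hn].
    - rewrite Nat.min_l in * by lia; rewrite S_INR.
      specialize (Hf (Z.of_nat (S n))); lra.
    - rewrite Hsupport, Nat.min_r by lia; rewrite Nat.min_r in IH by lia; lra. }
  eapply Rle_trans; [exact Hmin|].
  apply Rmult_le_compat_l; [exact HC|apply le_INR, Nat.le_min_r].
Qed.

Definition one_sided (y : state) : Prop := Nat.min (fst y) (snd y) = 0%nat.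

Definition reachable (y : state) : Prop := (Nat.min (fst y) (snd y) <= 1)%nat.

Definition post_decision (y : state) (a : bool) : state :=
  ((fst y - act_nat a)%nat, (snd y - act_nat a)%nat).

Lemma post_decision_wait (y : state) : post_decision y false = y.
Proof. destruct y as [i j]; unfold post_decision; simpl; rewrite !Nat.sub_0_r; auto. Qed.

Lemma trans_post_decision (p1 p2 : R) (y : state) (a : bool) :
  trans p1 p2 y a = trans p1 p2 (post_decision y a) false.
Proof.
  destruct a; [|rewrite post_decision_wait; reflexivity].
  destruct y as [i j]; unfold trans, post_decision; cbn [fst snd act_nat].
  replace (Nat.max i 1) with (S (i - 1)) by lia.
  replace (Nat.max j 1) with (S (j - 1)) by lia; reflexivity.
Qed.

Lemma trans_reachable (p1 p2 : R) (y : state) (a : bool) (e : R * state) :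
  one_sided (post_decision y a) -> In e (trans p1 p2 y a) -> reachable (snd e).
Proof.
  rewrite trans_post_decision; destruct (post_decision y a) as [i j].
  unfold one_sided, reachable; intros Hx He; simpl in He.
  repeat destruct He as [He|He]; try contradiction; subst e; cbn [fst snd] in *; lia.
Qed.

Lemma trans_prob_nonneg (p1 p2 : R) (y : state) (a : bool) (e : R * state) :
  0 <= p1 <= 1 -> 0 <= p2 <= 1 -> In e (trans p1 p2 y a) -> 0 <= fst e.
Proof.
  intros Hp1 Hp2 He; destruct y as [i j], a; simpl in He;
    repeat destruct He as [He|He]; try contradiction;
    subst e; apply Rmult_le_pos; lra.
Qed.

Definition expected_next (p1 p2 : R) (F : state -> R) (y : state) (a : bool) : R :=
  fold_right (fun e acc => fst e * F (snd e) + acc) 0 (trans p1 p2 y a).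

Lemma expected_next_le (p1 p2 : R) (F F' : state -> R) (y : state) (a : bool) :
  0 <= p1 <= 1 -> 0 <= p2 <= 1 ->
  (forall e, In e (trans p1 p2 y a) -> F (snd e) <= F' (snd e)) ->
  expected_next p1 p2 F y a <= expected_next p1 p2 F' y a.
Proof.
  intros Hp1 Hp2 HF; unfold expected_next.
  assert (Hprob := fun e => trans_prob_nonneg p1 p2 y a e Hp1 Hp2).
  induction (trans p1 p2 y a) as [|e l IH]; simpl; [lra|].
  apply Rplus_le_compat.
  - apply Rmult_le_compat_l; [apply Hprob|apply HF]; left; reflexivity.
  - apply IH; intros; [apply HF|apply Hprob]; right; assumption.
Qed.

Lemma expected_next_shift (p1 p2 k : R) (F : state -> R) (y : state) (a : bool) :
  expected_next p1 p2 (fun z => k + F z) y a = k + expected_next p1 p2 F y a.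
Proof. destruct y, a; unfold expected_next; simpl; ring. Qed.

Definition post_value (Ct : R) (f : Z -> R) (x : state) : R :=
  partial_sum f (fst x) + partial_sum (reflect Ct f) (snd x).

Definition pre_value (Ct : R) (f : Z -> R) (y : state) : R :=
  match y with
  | (S i, S j) => Ct + post_value Ct f (i, j)
  | _ => post_value Ct f y
  end.

Definition backlog (x : state) : Z := (Z.of_nat (fst x) - Z.of_nat (snd x))%Z.

Lemma pre_value_one_sided (Ct : R) (f : Z -> R) (y : state) :
  one_sided y -> pre_value Ct f y = post_value Ct f y.
Proof. destruct y as [[|i] [|j]]; [reflexivity..|]; intros Hy; discriminate Hy. Qed.

Lemma pre_value_le_post_decision (Ct : R) (f : Z -> R) (y : state) (a : bool) :
  (forall x, 0 <= f x <= Ct) -> one_sided (post_decision y a) ->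
  pre_value Ct f y <= Ct * INR (act_nat a) + post_value Ct f (post_decision y a).
Proof.
  intros Hf Hy; destruct a.
  - simpl INR; rewrite Rmult_1_r; assert (HCt := Hf 0%Z).
    destruct y as [[|i] [|j]]; unfold pre_value, post_value, post_decision;
      cbn [fst snd act_nat]; rewrite ?Nat.sub_succ, ?Nat.sub_0_r; simpl Nat.sub;
      cbn [partial_sum]; try lra.
    + specialize (Hf (1 - Z.of_nat (S j))%Z); unfold reflect at 2; lra.
    + specialize (Hf (Z.of_nat (S i))); lra.
  - rewrite post_decision_wait in *; rewrite pre_value_one_sided by exact Hy.
    simpl; lra.
Qed.

Lemma cost_post_decision (Ch Ct : R) (y : state) (a : bool) :
  one_sided (post_decision y a) ->
  cost Ch Ct y a = Ct * INR (act_nat a) + Ch * IZR (Z.abs (backlog (post_decision y a))).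
Proof.
  unfold cost, one_sided, backlog, post_decision; cbn [fst snd]; intros Hy.
  rewrite INR_IZR_INZ, Rplus_comm; do 3 f_equal; lia.
Qed.

Lemma bellman_drift (p1 p2 Ch Ct : R) (f : Z -> R) (y : state) (a : bool) :
  one_sided (post_decision y a) ->
  cost Ch Ct y a + expected_next p1 p2 (pre_value Ct f) y a
  = Ct * INR (act_nat a) + post_value Ct f (post_decision y a)
    + drift p1 p2 Ch Ct f (backlog (post_decision y a)).
Proof.
  intros Hx; rewrite cost_post_decision by exact Hx.
  unfold expected_next; rewrite trans_post_decision.
  destruct (post_decision y a) as [[|i] [|j]]; [| | |discriminate Hx];
    unfold trans, drift, pre_value, post_value, backlog;
    cbn [fold_right fst snd partial_sum]; unfold reflect.
  - simpl; ring.
  - replace (Z.of_nat 0 - Z.of_nat (S j) + 1)%Z with (1 - Z.of_nat (S j))%Z by lia.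
    replace (1 - Z.of_nat (S (S j)))%Z with (Z.of_nat 0 - Z.of_nat (S j))%Z by lia.
    ring.
  - replace (Z.of_nat (S i) - Z.of_nat 0 + 1)%Z with (Z.of_nat (S (S i))) by lia.
    replace (1 - Z.of_nat 1)%Z with 0%Z by lia.
    replace (Z.of_nat (S i) - Z.of_nat 0)%Z with (Z.of_nat (S i)) by lia.
    ring.
Qed.

Lemma pre_value_nonneg (Ct : R) (f : Z -> R) (y : state) :
  (forall x, 0 <= f x <= Ct) -> 0 <= pre_value Ct f y.
Proof.
  intros Hf.
  assert (Hpost : forall x, 0 <= post_value Ct f x).
  { intros x; apply Rplus_le_le_0_compat; apply partial_sum_nonneg; intros z;
      [apply Hf|unfold reflect; specialize (Hf (1 - z)%Z); lra]. }
  destruct y as [[|i] [|j]]; try apply Hpost.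
  specialize (Hf 0%Z); apply Rplus_le_le_0_compat; [lra|apply Hpost].
Qed.

Lemma pre_value_le_of_support (Ct : R) (K : nat) (f : Z -> R) (y : state) :
  (forall x, 0 <= f x <= Ct) -> (forall x, (Z.of_nat K < x)%Z -> f x = 0) ->
  (forall x, (x <= - Z.of_nat K)%Z -> f x = Ct) ->
  pre_value Ct f y <= Ct + 2 * (Ct * INR K).
Proof.
  intros Hf Hright Hleft; assert (HCt : 0 <= Ct) by (specialize (Hf 0%Z); lra).
  assert (Hpost : forall x, post_value Ct f x <= 2 * (Ct * INR K)).
  { intros x; rewrite <- Rplus_diag; apply Rplus_le_compat;
      apply partial_sum_le_of_support; auto; unfold reflect.
    - intros z; apply Hf.
    - intros z; specialize (Hf (1 - z)%Z); lra.
    - intros z Hz; rewrite Hleft by lia; ring. }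
  specialize (Hpost y) as Hy.
  destruct y as [[|i] [|j]]; unfold pre_value; try lra.
  specialize (Hpost (i, j)); lra.
Qed.

(** * Verification of long-run averages *)

Definition mix (q : R) (F : bool -> R) : R := q * F true + (1 - q) * F false.

Lemma mix_indicator (a : bool) (F : bool -> R) : mix (if a then 1 else 0) F = F a.
Proof. unfold mix; destruct a; ring. Qed.

(* Only waiting with both queues nonempty leaves a two-sided state, and an admissible
   policy gives it weight [0]. *)
Lemma admissible_mix_ge (pol : policy) (h : history) (y : state) (m : R) (F : bool -> R) :
  admissible pol -> reachable y ->
  (forall a, one_sided (post_decision y a) -> m <= F a) -> m <= mix (pol h y) F.
Proof.
  intros Hpol Hy HF; destruct (Hpol h y) as [Hprob [_ Hforced]]; unfold mix.
  assert (Htransmit : m <= F true).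
  { apply HF; unfold one_sided, reachable, post_decision in *.
    cbn [fst snd act_nat]; lia. }
  destruct (Nat.eq_dec (Nat.min (fst y) (snd y)) 0) as [Hside|Hside].
  - assert (Hwait : m <= F false) by (apply HF; rewrite post_decision_wait; exact Hside).
    nra.
  - rewrite Hforced by (apply Nat.mul_pos_pos; lia); lra.
Qed.

Section AverageCost.

Variables p1 p2 Ch Ct : R.
Hypothesis p1_prob : 0 <= p1 <= 1.
Hypothesis p2_prob : 0 <= p2 <= 1.

(* [exp_cost] with horizon [N] has [N + 1] stages; [total_cost] counts the stages. *)
Definition total_cost (pol : policy) (n : nat) (h : history) (y : state) : R :=
  match n with
  | O => 0
  | S N => exp_cost p1 p2 Ch Ct pol N h y
  end.

Lemma total_cost_S (pol : policy) (n : nat) (h : history) (y : state) :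
  total_cost pol (S n) h y =
  mix (pol h y) (fun a =>
    cost Ch Ct y a + expected_next p1 p2 (total_cost pol n (h ++ [(y, a)])) y a).
Proof.
  destruct n as [|n]; [|reflexivity].
  destruct y; unfold mix, expected_next; simpl; ring.
Qed.

Lemma total_cost_ge (V : state -> R) (g B : R) (pol : policy) (n : nat) :
  admissible pol -> (forall y, V y <= B) ->
  (forall y a, reachable y -> one_sided (post_decision y a) ->
    g + V y <= cost Ch Ct y a + expected_next p1 p2 V y a) ->
  forall h y, reachable y -> INR n * g - B + V y <= total_cost pol n h y.
Proof.
  intros Hpol HB Hbellman; induction n as [|n IH]; intros h y Hy.
  - specialize (HB y); simpl; lra.
  - rewrite total_cost_S; apply admissible_mix_ge; auto; intros a Ha.
    assert (Hnext : expected_next p1 p2 (fun z => INR n * g - B + V z) y a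
              <= expected_next p1 p2 (total_cost pol n (h ++ [(y, a)])) y a).
    { apply expected_next_le; auto; intros e He.
      apply IH; exact (trans_reachable _ _ _ _ _ Ha He). }
    rewrite expected_next_shift in Hnext; rewrite S_INR.
    specialize (Hbellman y a Hy Ha); lra.
Qed.

Lemma total_cost_le (V : state -> R) (g : R) (pol : policy) (act : state -> bool)
    (invariant : state -> Prop) (n : nat) :
  (forall h y, pol h y = if act y then 1 else 0) ->
  (forall y e, invariant y -> In e (trans p1 p2 y (act y)) -> invariant (snd e)) ->
  (forall y, 0 <= V y) ->
  (forall y, invariant y ->
    cost Ch Ct y (act y) + expected_next p1 p2 V y (act y) <= g + V y) ->
  forall h y, invariant y -> total_cost pol n h y <= INR n * g + V y.
Proof.
  intros Hact Hinv HV Hbellman; induction n as [|n IH]; intros h y Hy.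
  - specialize (HV y); simpl; lra.
  - rewrite total_cost_S, Hact, mix_indicator.
    assert (Hnext : expected_next p1 p2 (total_cost pol n (h ++ [(y, act y)])) y (act y)
              <= expected_next p1 p2 (fun z => INR n * g + V z) y (act y)).
    { apply expected_next_le; auto; intros e He.
      apply IH; exact (Hinv y e Hy He). }
    rewrite expected_next_shift in Hnext; rewrite S_INR.
    specialize (Hbellman y Hy); lra.
Qed.

End AverageCost.

Lemma is_lim_seq_offset_average (g B : R) :
  is_lim_seq (fun n => (INR (S n) * g + B) / INR (S n)) g.
Proof.
  apply is_lim_seq_ext with (fun n => g + B * / INR (S n)).
  { intros n; field; apply not_0_INR; discriminate. }
  replace (Finite g) with (Finite (g + B * 0)) by (f_equal; ring).
  apply is_lim_seq_plus'; [apply is_lim_seq_const|].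
  apply (is_lim_seq_scal_l _ B (Finite 0)).
  apply -> (is_lim_seq_incr_1 (fun n => / INR n)).
  apply (is_lim_seq_inv INR p_infty is_lim_seq_INR); discriminate.
Qed.

Lemma LimSup_offset_average (g B : R) :
  LimSup_seq (fun n => (INR (S n) * g + B) / INR (S n)) = g.
Proof. apply is_LimSup_seq_unique, is_lim_LimSup_seq, is_lim_seq_offset_average. Qed.

Lemma LimSup_average_le_compat (u v : nat -> R) :
  (forall n, u n <= v n) ->
  Rbar_le (LimSup_seq (fun n => u n / INR (S n))) (LimSup_seq (fun n => v n / INR (S n))).
Proof.
  intros Huv; apply LimSup_le; exists O; intros n _.
  apply Rmult_le_compat_r; [|apply Huv].
  apply Rlt_le, Rinv_0_lt_compat, lt_0_INR; lia.
Qed.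

(** * Optimality of the threshold policy *)

Definition threshold_action (L1 L2 : nat) (y : state) : bool :=
  (Nat.ltb 0 (fst y * snd y) || Nat.ltb L1 (fst y) || Nat.ltb L2 (snd y))%bool.

Lemma threshold_action_true_iff (L1 L2 : nat) (y : state) :
  threshold_action L1 L2 y = true <->
  (0 < fst y * snd y \/ L1 < fst y \/ L2 < snd y)%nat.
Proof.
  unfold threshold_action; rewrite !Bool.orb_true_iff, !Nat.ltb_lt; tauto.
Qed.

Lemma threshold_policy_action (L1 L2 : nat) (h : history) (y : state) :
  threshold_policy L1 L2 h y = if threshold_action L1 L2 y then 1 else 0.
Proof.
  destruct y as [i j]; unfold threshold_policy, threshold_action; cbn [fst snd].
  destruct (Nat.ltb_spec 0 (i * j)); [reflexivity|].
  destruct (Nat.eqb_spec j 0) as [->|Hj].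
  - rewrite Bool.orb_false_r; reflexivity.
  - assert (i = O) as -> by nia; reflexivity.
Qed.

Lemma threshold_policy_admissible (L1 L2 : nat) : admissible (threshold_policy L1 L2).
Proof.
  intros h y; rewrite threshold_policy_action; unfold threshold_action.
  destruct y as [i j]; cbn [fst snd].
  destruct (Nat.ltb_spec 0 (i * j)), (Nat.ltb_spec L1 i), (Nat.ltb_spec L2 j);
    simpl; repeat split; intros; lra || lia || nia.
Qed.

Definition threshold_reachable (L1 L2 : nat) (y : state) : Prop :=
  reachable y /\ (fst y <= S L1)%nat /\ (snd y <= S L2)%nat.

Definition threshold_band (L1 L2 : nat) (x : state) : Prop :=
  one_sided x /\ (fst x <= L1)%nat /\ (snd x <= L2)%nat.

Lemma threshold_action_band (L1 L2 : nat) (y : state) :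
  threshold_reachable L1 L2 y ->
  threshold_band L1 L2 (post_decision y (threshold_action L1 L2 y)).
Proof.
  destruct y as [i j]; unfold threshold_reachable, threshold_band, reachable, one_sided,
    post_decision, threshold_action; cbn [fst snd].
  destruct (Nat.ltb_spec 0 (i * j)), (Nat.ltb_spec L1 i), (Nat.ltb_spec L2 j);
    cbn [orb act_nat]; nia.
Qed.

Lemma threshold_reachable_invariant (p1 p2 : R) (L1 L2 : nat) (y : state)
    (e : R * state) :
  threshold_reachable L1 L2 y -> In e (trans p1 p2 y (threshold_action L1 L2 y)) ->
  threshold_reachable L1 L2 (snd e).
Proof.
  intros Hy He; destruct (threshold_action_band L1 L2 y Hy) as [Hside [Hi Hj]].
  split; [exact (trans_reachable _ _ _ _ _ Hside He)|].
  rewrite trans_post_decision in He; destruct (post_decision _ _) as [i j].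
  simpl in He, Hi, Hj.
  repeat destruct He as [He|He]; try contradiction; subst e; simpl; lia.
Qed.

Section Bellman.

Variables (p1 p2 Ch Ct g : R) (f : Z -> R) (L1 L2 : nat).
Hypothesis f_certificate : threshold_certificate p1 p2 Ch Ct f g L1 L2.

Lemma bellman_inequality (y : state) (a : bool) :
  one_sided (post_decision y a) ->
  g + pre_value Ct f y <= cost Ch Ct y a + expected_next p1 p2 (pre_value Ct f) y a.
Proof.
  destruct f_certificate as [Hf _ _ Hge _]; intros Hside.
  rewrite bellman_drift, Rplus_comm by exact Hside.
  apply Rplus_le_compat; [apply pre_value_le_post_decision; assumption|apply Hge].
Qed.

Lemma pre_value_threshold_action (y : state) :
  threshold_reachable L1 L2 y ->
  pre_value Ct f y = Ct * INR (act_nat (threshold_action L1 L2 y))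
    + post_value Ct f (post_decision y (threshold_action L1 L2 y)).
Proof.
  destruct f_certificate as [_ Hright Hleft _ _]; intros Hy.
  assert (Hband := threshold_action_band L1 L2 y Hy).
  destruct (threshold_action L1 L2 y) eqn:Haction.
  - apply threshold_action_true_iff in Haction; destruct Hy as [_ [Hi Hj]].
    destruct y as [[|i] [|j]]; cbn [fst snd] in *;
      unfold pre_value, post_value, post_decision; cbn [fst snd act_nat];
      rewrite ?Nat.sub_succ, ?Nat.sub_0_r; simpl Nat.sub;
      cbn [partial_sum INR]; try ring.
    + lia.
    + assert (j = L2) as -> by lia.
      unfold reflect at 2; replace (1 - Z.of_nat (S L2))%Z with (- Z.of_nat L2)%Z by lia.
      rewrite Hleft; ring.
    + assert (i = L1) as -> by lia.
      rewrite Nat2Z.inj_succ; unfold Z.succ; rewrite Hright; ring.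
  - rewrite post_decision_wait in *; rewrite pre_value_one_sided by apply Hband.
    simpl; ring.
Qed.

Lemma bellman_equality (y : state) :
  threshold_reachable L1 L2 y ->
  cost Ch Ct y (threshold_action L1 L2 y)
    + expected_next p1 p2 (pre_value Ct f) y (threshold_action L1 L2 y)
  = g + pre_value Ct f y.
Proof.
  intros Hy; destruct (threshold_action_band L1 L2 y Hy) as [Hside [Hi Hj]].
  rewrite pre_value_threshold_action, bellman_drift by assumption.
  destruct f_certificate as [_ _ _ _ Heq]; rewrite Heq by (unfold backlog; lia); ring.
Qed.

Hypothesis p1_prob : 0 <= p1 <= 1.
Hypothesis p2_prob : 0 <= p2 <= 1.

Lemma avg_cost_ge (B : R) (pol : policy) :
  (forall y, pre_value Ct f y <= B) -> admissible pol ->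
  Rbar_le g (avg_cost p1 p2 Ch Ct pol).
Proof.
  intros HB Hpol.
  rewrite <- (LimSup_offset_average g (- B + pre_value Ct f (0, 0)%nat)).
  apply LimSup_average_le_compat; intros n; rewrite <- Rplus_assoc.
  apply (total_cost_ge p1 p2 Ch Ct p1_prob p2_prob (pre_value Ct f) g B pol (S n));
    [exact Hpol|exact HB| |].
  - intros y a _; apply bellman_inequality.
  - unfold reachable; simpl; lia.
Qed.

Lemma avg_cost_threshold_le :
  Rbar_le (avg_cost p1 p2 Ch Ct (threshold_policy L1 L2)) g.
Proof.
  rewrite <- (LimSup_offset_average g (pre_value Ct f (0, 0)%nat)).
  apply LimSup_average_le_compat; intros n.
  apply (total_cost_le p1 p2 Ch Ct p1_prob p2_prob (pre_value Ct f) g _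
           (threshold_action L1 L2) (threshold_reachable L1 L2) (S n)).
  - apply threshold_policy_action.
  - intros y e; apply threshold_reachable_invariant.
  - intros y; apply pre_value_nonneg, (certificate_bounds f_certificate).
  - intros y Hy; apply Req_le, bellman_equality, Hy.
  - repeat split; [unfold reachable| |]; simpl; lia.
Qed.

End Bellman.

Theorem theorem3 (p1 p2 Ct Ch : R) :
  0 < p1 < 1 -> 0 < p2 < 1 -> 0 < Ct -> 0 < Ch ->
  exists L1 L2 : nat,
    admissible (threshold_policy L1 L2) /\
    forall pol : policy, admissible pol ->
      Rbar_le (avg_cost p1 p2 Ch Ct (threshold_policy L1 L2))
              (avg_cost p1 p2 Ch Ct pol).
Proof.
  intros Hp1 Hp2 HCt HCh.
  assert (Hp1_prob : 0 <= p1 <= 1) by lra.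
  assert (Hp2_prob : 0 <= p2 <= 1) by lra.
  assert (HCt_nonneg : 0 <= Ct) by lra.
  destruct (monotone_solution_exists p1 p2 Ch Ct) as [f Hf]; auto.
  destruct (monotone_solution_threshold_certificate p1 p2 Ch Ct f)
    as [L1 [L2 Hcert]]; auto.
  destruct (threshold_certificate_truncate p1 p2 Ch Ct f (drift p1 p2 Ch Ct f 0) L1 L2)
    as [K Htruncated]; auto.
  exists L1, L2; split; [apply threshold_policy_admissible|]; intros pol Hpol.
  apply Rbar_le_trans with (drift p1 p2 Ch Ct f 0).
  - apply avg_cost_threshold_le with (truncate Ct K f); assumption.
  - apply avg_cost_ge with (truncate Ct K f) L1 L2 (Ct + 2 * (Ct * INR K)); auto.
    intros y; apply pre_value_le_of_support;
      [apply (certificate_bounds Htruncated)|apply truncate_right|apply truncate_left].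
Qed.
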